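(* Let $\rho\in(0,1)$, and let $r=2\rho/(1+\rho^2)$ (equivalently, $r\in(0,1)$ is determined by $\rho=r/(1+\sqrt{1-r^2})$). Consider real $\varepsilon$ small enough that $(2\rho\varepsilon+\varepsilon^2)/(1+\rho^2)<1$. Let $\rho_k=\rho+\varepsilon$ and define $r_{k+1}=2\rho_k/(1+\rho_k^2)$. Then $$r_{k+1}=r+\widehat\varepsilon+\mathcal{O}(\varepsilon^2)\quad\text{with}\quad \widehat\varepsilon=\varepsilon\,\frac{2(1-\rho^2)}{(1+\rho^2)^2}.$$
   Context: The $\mathcal{O}(\varepsilon^2)$ is for fixed $\rho$ as $\varepsilon\to0$. In the application, $r=|\lambda_2/\lambda_1|$ is the ratio of the two largest-magnitude eigenvalues of a matrix and $\rho=r/(1+\sqrt{1-r^2})$ is the corresponding optimal convergence rate of the power iteration with momentum; only the relation between $r$ and $\rho$ is needed. *)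

(* Defs.v *)
From mathcomp Require Import all_boot all_order all_algebra.
From mathcomp Require Import all_classical all_reals all_analysis.

Set Implicit Arguments.
Unset Strict Implicit.
Unset Printing Implicit Defensive.

Import Order.TTheory GRing.Theory Num.Theory.
Import numFieldNormedType.Exports.

Local Open Scope classical_set_scope.
Local Open Scope ring_scope.

(* With r = |lambda_2 / lambda_1|, this is the optimal convergence rate of the
   power iteration with momentum. *)
Definition optimal_rate (R : realType) (r : R) : R :=
  r / (1 + Num.sqrt (1 - r ^+ 2)).

Definition ratio_of_rate (R : realType) (rho : R) : R :=
  2 * rho / (1 + rho ^+ 2).

Definition eps_hat (R : realType) (rho eps : R) : R :=
  eps * (2 * (1 - rho ^+ 2) / (1 + rho ^+ 2) ^+ 2).

(* No lower bound on eps is imposed: eps may be negative. *)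
Definition admissible_eps (R : realType) (rho : R) : set R :=
  [set eps | (2 * rho * eps + eps ^+ 2) / (1 + rho ^+ 2) < 1].

(* Main.v *)
Require Import Defs.
From mathcomp Require Import all_boot all_order all_algebra.
From mathcomp Require Import all_classical all_reals all_analysis.
From mathcomp Require Import ring lra.

(** The value [s = 2 x / (1 + x^2)] is the sine of twice the arctangent of [x],
    and the corresponding cosine [(1 - x^2) / (1 + x^2)] is the square root
    [sqrt (1 - s^2)] when [x] lies in the unit interval.  The half-angle
    formula then says that [optimal_rate] and [ratio_of_rate] invert each other
    on that interval, which characterizes [r].

    For the expansion, [eps_hat] is the first-order Taylor term of
    [ratio_of_rate] at [rho], and the Taylor remainder is computed exactly as a
    rational function ([ratio_of_rate_taylor]): it is [eps^2] times a quotient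
    that stays bounded as [eps] ranges over the reals, since the numerator grows
    linearly in [y = rho + eps] and the denominator contains [1 + y^2 >= |y|].
    Hence [ratio_of_rate_remainder_le], a bound by [8 eps^2] on the whole line,
    which gives the O-estimate along any filter. *)

Set Implicit Arguments.
Unset Strict Implicit.
Unset Printing Implicit Defensive.

Import Order.TTheory GRing.Theory Num.Theory.
Import numFieldNormedType.Exports.

Local Open Scope classical_set_scope.
Local Open Scope ring_scope.

Lemma one_add_sqr_gt0 (R : realType) (x : R) : 0 < 1 + x ^+ 2.
Proof. by rewrite ltr_wpDr ?sqr_ge0. Qed.

Lemma ratio_of_rate_itv (R : realType) (x : R) :
  0 < x < 1 -> 0 < ratio_of_rate x < 1.
Proof.
move=> /andP[x0 x1]; rewrite /ratio_of_rate.
have D0 := one_add_sqr_gt0 x.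
rewrite divr_gt0 ?mulr_gt0 //= ltr_pdivrMr // mul1r.
(* the difference of the two sides is the square of [1 - x] *)
have : 0 < (1 - x) ^+ 2 by rewrite exprn_gt0 // subr_gt0.
nra.
Qed.

(** With [x] the tangent of an angle, this is [sqrt (1 - sin^2) = cos] for the
    double angle, whose cosine is nonnegative because [x <= 1]. *)
Lemma sqrt_one_sub_ratio_of_rate (R : realType) (x : R) : 0 <= x <= 1 ->
  Num.sqrt (1 - ratio_of_rate x ^+ 2) = (1 - x ^+ 2) / (1 + x ^+ 2).
Proof.
move=> /andP[x0 x1].
have D0 := one_add_sqr_gt0 x.
have -> : 1 - ratio_of_rate x ^+ 2 = ((1 - x ^+ 2) / (1 + x ^+ 2)) ^+ 2.
  by rewrite /ratio_of_rate; field; rewrite gt_eqF.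
by rewrite sqrtr_sqr ger0_norm // divr_ge0 ?(ltW D0) // subr_ge0 expr_le1.
Qed.

Lemma ratio_of_rateK (R : realType) (x : R) : 0 <= x <= 1 ->
  optimal_rate (ratio_of_rate x) = x.
Proof.
move=> x01; rewrite /optimal_rate sqrt_one_sub_ratio_of_rate // /ratio_of_rate.
have D0 := one_add_sqr_gt0 x.
field; rewrite (gt_eqF D0) /=; apply/eqP => h; lra.
Qed.

(** With [t = sqrt (1 - s^2)], the relation [t^2 + s^2 = 1] turns
    [(1 + t)^2 + s^2] into [2 (1 + t)], and one factor [1 + t] cancels. *)
Lemma optimal_rateK (R : realType) (s : R) : -1 <= s <= 1 ->
  ratio_of_rate (optimal_rate s) = s.
Proof.
move=> /andP[s0 s1]; rewrite /optimal_rate.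
have s2 : 0 <= 1 - s ^+ 2 by nra.
have := sqr_sqrtr s2; have := sqrtr_ge0 (1 - s ^+ 2).
set t := Num.sqrt _ => t0 tE.
have T0 : 1 + t != 0 by rewrite gt_eqF // ltr_wpDr.
have E : 1 + (s / (1 + t)) ^+ 2 = 2 / (1 + t).
  have -> : 1 + (s / (1 + t)) ^+ 2 = ((1 + t) ^+ 2 + s ^+ 2) / (1 + t) ^+ 2.
    by field.
  have -> : s ^+ 2 = 1 - t ^+ 2 by rewrite tE; ring.
  by field.
by rewrite /ratio_of_rate E; field.
Qed.

Lemma ratio_of_rate_taylor (R : realType) (x e : R) :
  ratio_of_rate (x + e) - (ratio_of_rate x + eps_hat x e) =
  - (2 * e ^+ 2 * (x * (1 + x ^+ 2) + (1 - x ^+ 2) * (2 * x + e))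
     / ((1 + x ^+ 2) ^+ 2 * (1 + (x + e) ^+ 2))).
Proof.
rewrite /ratio_of_rate /eps_hat; field.
by rewrite !gt_eqF ?one_add_sqr_gt0.
Qed.

(** With [y = x + e], the bracket in the exact remainder collapses to
    [2 x + (1 - x^2) y], which is at most [2 + |y|] in absolute value; the factor
    [1 + y^2] of the denominator dominates both [1] and [|y|]. *)
Lemma ratio_of_rate_remainder_le (R : realType) (x e : R) : 0 <= x <= 1 ->
  `|ratio_of_rate (x + e) - (ratio_of_rate x + eps_hat x e)| <= 8 * e ^+ 2.
Proof.
move=> /andP[x0 x1]; rewrite ratio_of_rate_taylor normrN.
set y := x + e; have -> : 2 * x + e = x + y by rewrite /y; ring.
have D0 : 0 < (1 + x ^+ 2) ^+ 2 by rewrite exprn_gt0 ?one_add_sqr_gt0.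
have Dy0 := one_add_sqr_gt0 y.
have Q0 := mulr_gt0 D0 Dy0.
rewrite normrM normfV (gtr0_norm Q0) ler_pdivrMr //.
have D1 : 1 <= (1 + x ^+ 2) ^+ 2 by rewrite exprn_ege1 // lerDl sqr_ge0.
have Dy1 : 1 <= 1 + y ^+ 2 by rewrite lerDl sqr_ge0.
have xx : 0 <= x ^+ 2 <= 1 by rewrite sqr_ge0 expr_le1.
have ny : `|y| <= 1 + y ^+ 2.
  rewrite -real_normK ?num_real //; have := sqr_ge0 (`|y| - 1); nra.
have num : `|x * (1 + x ^+ 2) + (1 - x ^+ 2) * (x + y)| <= 4 * (1 + y ^+ 2).
  have -> : x * (1 + x ^+ 2) + (1 - x ^+ 2) * (x + y) = 2 * x + (1 - x ^+ 2) * y.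
    by ring.
  apply: le_trans (ler_normD _ _) _.
  rewrite normrM (ger0_norm x0) (ger0_norm (ler0n _ 2)) normrM ger0_norm; last lra.
  have := normr_ge0 y; nra.
rewrite normrM ger0_norm; last by rewrite mulr_ge0 ?ler0n ?sqr_ge0.
have e2 := sqr_ge0 e.
have step : 2 * e ^+ 2 * `|x * (1 + x ^+ 2) + (1 - x ^+ 2) * (x + y)|
            <= 8 * e ^+ 2 * (1 + y ^+ 2) by nra.
apply: le_trans step _.
by apply: ler_wpM2l; [exact: mulr_ge0|exact: ler_peMl (ltW Dy0) D1].
Qed.

Theorem lemma3p4 (R : realType) (rho r : R)
    (hrho : 0 < rho < 1) (hr : r = ratio_of_rate rho) :
  (forall s : R, s = r <-> 0 < s < 1 /\ rho = optimal_rate s) /\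
  (fun eps : R => ratio_of_rate (rho + eps)) =
    (fun eps : R => r + eps_hat rho eps)
    +O_ (within (admissible_eps rho) (nbhs (0 : R)))
       (fun eps : R => eps ^+ 2).
Proof.
have rho01 : 0 <= rho <= 1 by case/andP: hrho => h0 h1; rewrite !ltW.
subst r; split.
  move=> s; split=> [->|[/andP[s0 s1] ->]].
    by rewrite ratio_of_rate_itv // ratio_of_rateK.
  by rewrite optimal_rateK // (ltW s1) andbT; lra.
apply/eqaddOP; near=> k; apply: nearW => eps.
apply: le_trans (ratio_of_rate_remainder_le eps rho01) _.
rewrite (ger0_norm (sqr_ge0 eps)) ler_wpM2r ?sqr_ge0 //.
Unshelve. all: by end_near. Qed.
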